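(* Let $(G,\mathsf X)$ be a contracting self-similar group such that $G$ is finitely generated and the action is self-replicating, let $\mathfrak M=\mathsf X\cdot G$ be its self-similarity bimodule, $\Gamma$ its tiling nerve, and $I^{(n)}:\Gamma\otimes\mathfrak M^{\otimes n}\to\Gamma$ the natural $G$-equivariant maps. Then there exists $n\ge1$ such that the map $I^{(n)}:\Gamma\otimes\mathfrak M^{\otimes n}\to\Gamma$ is $G$-equivariantly homotopic (i.e., homotopic through $G$-equivariant maps) to a contracting map.
   Context: **Self-similar groups.** A permutational $G$-bimodule is a set with commuting left and right $G$-actions; it is a covering bimodule if the right action is free with finitely many orbits; a basis is a set meeting each right orbit once. A self-similar group $(G,\mathsf X)$ is given by a covering bimodule $\mathfrak M=\mathsf X\cdot G$ with basis $\mathsf X$: $g\cdot x=g(x)\cdot g|_x$ with $g(x)\in\mathsf X$, $g|_x\in G$. It is self-replicating if the left action of $G$ on $\mathfrak M$ is transitive. $\mathfrak M_1\otimes\mathfrak M_2$ is the quotient of $\mathfrak M_1\times\mathfrak M_2$ by $x_1\cdot g\otimes x_2=x_1\otimes g\cdot x_2$; $\mathfrak M^{\otimes n}$ has basis $\mathsf X^n$ (words of length $n$), and $g\cdot v=g(v)\cdot g|_v$ for $v\in\mathsf X^n$. For $A\subset G$ write $A|_v=\{g|_v:g\in A\}$. The group is contracting if there is a finite set $\mathcal N\subset G$ such that for every $g\in G$ one has $g|_v\in\mathcal N$ for all sufficiently long words $v$; the smallest such $\mathcal N$ is the nucleus. **Tiling nerve.** $\Gamma(G,\mathcal N)$ is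 the simplicial complex with vertex set $G$ in which a non-empty $A\subset G$ is a simplex iff $gh^{-1}\in\mathcal N$ for all $g,h\in A$; $G$ acts on it by right translations. The tensor product $\mathcal X\otimes\mathfrak M$ of a right $G$-space and $\mathfrak M$ is the quotient of $\mathcal X\times\mathfrak M$ by $\xi\cdot g\otimes x=\xi\otimes g\cdot x$, with action $(\xi\otimes x)\cdot g=\xi\otimes(x\cdot g)$. The maps $I^{(n)}:\Gamma(G,\mathcal N)\otimes\mathfrak M^{\otimes n}\to\Gamma(G,\mathcal N)$ are given by $I^{(n)}(\xi\otimes v\cdot h)=I_v(\xi)\cdot h$ for $v\in\mathsf X^n$, $h\in G$, where $I_v$ is the simplicial map acting on vertices by $I_v(g)=g|_v$; put $I=I^{(1)}$. The tiling nerve is the subcomplex $\Gamma=\bigcap_{n\ge0}I^{(n)}(\Gamma(G,\mathcal N)\otimes\mathfrak M^{\otimes n})$; it is invariant under $G$ and the $I_v$, so the $I^{(n)}$ restrict to $G$-equivariant maps $I^{(n)}:\Gamma\otimes\mathfrak M^{\otimes n}\to\Gamma$. **Contracting maps.** $\Gamma$ carries the length metric in which each simplex is a regular Euclidean simplex with unit edges. A $G$-equivariant continuous map $\Psi:\Gamma\otimes\mathfrak B\to\Gamma$, with $\mathfrak B$ a covering bimodule (here $\mathfrak B=\mathfrak M^{\otimes n}$), is contracting if there exist $k\ge1$, $0<\lambda<1$ such that $d(\Psi^{(k)}(\xi_1\otimes w),\Psi^{(k)}(\xi_2\otimes w))\le\lambda\,d(\xi_1,\xi_2)$ for all $\xi_1,\xi_2\in\Gamma$,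 $w\in\mathfrak B^{\otimes k}$, where $\Psi^{(k)}(\xi\otimes b_1\otimes\cdots\otimes b_k)=\Psi(\ldots\Psi(\Psi(\xi\otimes b_1)\otimes b_2)\ldots\otimes b_k)$. *)

(* Defs.v *)
From HB Require Import structures.
From mathcomp Require Import all_boot all_order all_algebra finmap.
From mathcomp Require Import all_classical all_reals all_analysis.

Set Implicit Arguments.
Unset Strict Implicit.
Unset Printing Implicit Defensive.

Import Order.TTheory GRing.Theory Num.Theory.
Import numFieldNormedType.Exports.

Local Open Scope classical_set_scope.
Local Open Scope ring_scope.
Local Open Scope quotient_scope.

Section Bimodules.
Variable G : groupType.

Definition finitely_generated : Prop :=
  exists A : {fset G}, forall H : {pred G},
    group_closed H -> {subset A <= H} -> forall g : G, g \in H.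

Record rset := RSet {
  rset_car :> choiceType;
  ract : rset_car -> G -> rset_car;
  ract1 : forall x, ract x 1%g = x;
  ractM : forall x g h, ract x (g * h)%g = ract (ract x g) h }.

Record bimodule := Bimodule {
  bim_rset :> rset;
  lact : G -> bim_rset -> bim_rset;
  lact1 : forall x, lact 1%g x = x;
  lactM : forall g h x, lact (g * h)%g x = lact g (lact h x);
  lractA : forall g x h, lact g (ract x h) = ract (lact g x) h }.

Definition free_right (B : bimodule) : Prop :=
  forall (b : B) (g : G), ract b g = b -> g = 1%g.

Definition finitely_many_orbits (B : bimodule) : Prop :=
  exists s : seq B, forall b : B, exists2 a, a \in s & exists g, b = ract a g.

Definition covering (B : bimodule) : Prop :=
  free_right B /\ finitely_many_orbits B.

(* The family e meets each right orbit at exactly one index; in particular e is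
   injective. *)
Definition is_basis (B : bimodule) (X : Type) (e : X -> B) : Prop :=
  forall b : B, exists! x : X, exists g : G, b = ract (e x) g.

Definition equivariant (S T : rset) (f : S -> T) : Prop :=
  forall x g, f (ract x g) = ract (f x) g.

Section Tensor.
Variables (S : rset) (B : bimodule).

(* The relation generated by (x.g, b) ~ (x, g.b); it is already an equivalence
   because G is a group. *)
Definition tensor_rel : rel (S * B) :=
  fun p q => `[< exists g : G, q.1 = ract p.1 g /\ p.2 = lact g q.2 >].

Lemma tensor_relP p q :
  reflect (exists g : G, q.1 = ract p.1 g /\ p.2 = lact g q.2) (tensor_rel p q).
Proof. exact: asboolP. Qed.

Fact tensor_rel_refl : reflexive tensor_rel.
Proof. by move=> p; apply/tensor_relP; exists 1%g; rewrite ract1 lact1. Qed.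

Fact tensor_rel_sym : symmetric tensor_rel.
Proof.
suff H p q : tensor_rel p q -> tensor_rel q p by move=> p q; apply/idP/idP; exact: H.
case: p q => [x b] [y c] /tensor_relP[g /= [-> ->]]; apply/tensor_relP.
by exists g^-1%g; rewrite /= -ractM -lactM mulgV mulVg ract1 lact1.
Qed.

Fact tensor_rel_trans : transitive tensor_rel.
Proof.
move=> q p r /tensor_relP[g [q1 p2]] /tensor_relP[h [r1 q2]].
by apply/tensor_relP; exists (g * h)%g; rewrite ractM lactM -q1 -q2.
Qed.

Canonical tensor_equiv :=
  EquivRel tensor_rel tensor_rel_refl tensor_rel_sym tensor_rel_trans.

Definition tensor : Type := {eq_quot tensor_equiv}.

HB.instance Definition _ := EqQuotient.copy tensor {eq_quot tensor_equiv}.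
HB.instance Definition _ := Choice.copy tensor {eq_quot tensor_equiv}.

Definition tens (x : S) (b : B) : tensor := \pi_tensor (x, b).

Lemma tens_eqP x b y c :
  tens x b = tens y c <-> exists g : G, y = ract x g /\ b = lact g c.
Proof.
split=> [/eqP|xy]; last by apply/eqP; rewrite eqmodE; exact/tensor_relP.
by rewrite eqmodE => /tensor_relP.
Qed.

Lemma tensE (t : tensor) : t = tens (repr t).1 (repr t).2.
Proof. by rewrite /tens -surjective_pairing reprK. Qed.

Definition tensor_ract (t : tensor) (g : G) : tensor :=
  tens (repr t).1 (ract (repr t).2 g).

Lemma tensor_ractE x b g : tensor_ract (tens x b) g = tens x (ract b g).
Proof.
rewrite /tensor_ract; have := tensE (tens x b); move: (repr _) => [y c] /=.
by move/tens_eqP => [k [-> ->]]; apply/esym/tens_eqP; exists k; rewrite lractA.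
Qed.

Fact tensor_ract1 t : tensor_ract t 1%g = t.
Proof. by rewrite (tensE t) tensor_ractE ract1. Qed.

Fact tensor_ractM t g h :
  tensor_ract t (g * h)%g = tensor_ract (tensor_ract t g) h.
Proof. by rewrite (tensE t) !tensor_ractE ractM. Qed.

Definition tensor_rset : rset := RSet tensor_ract1 tensor_ractM.

End Tensor.

Section TensorBimodule.
Variables M N : bimodule.

Definition tensor_lact (g : G) (t : tensor M N) : tensor M N :=
  tens (lact g (repr t).1) (repr t).2.

Lemma tensor_lactE g x b : tensor_lact g (tens x b) = tens (lact g x) b.
Proof.
rewrite /tensor_lact; have := tensE (tens x b); move: (repr _) => [y c] /=.
by move/tens_eqP => [k [-> ->]]; apply/esym/tens_eqP; exists k; rewrite lractA.
Qed.

Fact tensor_lact1 t : tensor_lact 1%g t = t.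
Proof. by rewrite (tensE t) tensor_lactE lact1. Qed.

Fact tensor_lactM g h t :
  tensor_lact (g * h)%g t = tensor_lact g (tensor_lact h t).
Proof. by rewrite (tensE t) !tensor_lactE lactM. Qed.

Fact tensor_lractA g (t : tensor_rset M N) h :
  tensor_lact g (ract t h) = ract (tensor_lact g t : tensor_rset M N) h.
Proof.
by rewrite /= (tensE t) tensor_ractE !tensor_lactE tensor_ractE.
Qed.

Definition tensor_bimodule : bimodule :=
  @Bimodule (tensor_rset M N) tensor_lact tensor_lact1 tensor_lactM tensor_lractA.

End TensorBimodule.

Fact regular_ractM (x g h : G) : (x * (g * h) = (x * g) * h)%g.
Proof. exact: mulgA. Qed.

Definition regular_rset : rset := @RSet G (fun x g => x * g)%g (@mulg1 G) regular_ractM.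

Fact regular_lactM (g h x : G) : ((g * h) * x = g * (h * x))%g.
Proof. by rewrite mulgA. Qed.

Definition regular_bimodule : bimodule :=
  @Bimodule regular_rset (fun g x => g * x)%g (@mul1g G) regular_lactM
    regular_ractM.

(* M^(n) = M (x) (M (x) ... (M (x) G)), where the bimodule G is the unit of the
   tensor product. *)
Fixpoint tpow (M : bimodule) (n : nat) : bimodule :=
  if n is n'.+1 then tensor_bimodule M (tpow M n') else regular_bimodule.

Lemma is_basis_inj (B : bimodule) X (e : X -> B) x y g :
  is_basis e -> e x = ract (e y) g -> x = y.
Proof.
move=> be exy; have [z [_ zu]] := be (e x).
have <- : z = x by apply: zu; exists 1%g; rewrite ract1.
by apply: zu; exists g.
Qed.

Lemma ract_inj (B : bimodule) (b : B) g h :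
  free_right B -> ract b g = ract b h -> g = h.
Proof.
move=> fB /(congr1 (fun c => ract c h^-1%g)).
rewrite -!ractM mulgV ract1 => /fB gh.
by rewrite -[g](mulgVK h) gh mul1g.
Qed.

Record self_similar := SelfSimilar {
  ss_bim :> bimodule;
  letter : finType;
  letter_elt : letter -> ss_bim;
  ss_covering : covering ss_bim;
  ss_basis : is_basis letter_elt }.

Section SelfSimilar.
Variable M : self_similar.

Local Notation X := (letter M).

Definition self_replicating : Prop := forall x y : M, exists g : G, lact g x = y.

(* The word x1 ... xn, seen as x1 (x) ... (x) xn in M^(n). *)
Fixpoint word_elt (n : nat) : n.-tuple X -> tpow M n :=
  match n with
  | 0 => fun _ => 1%g : regular_bimodule
  | n'.+1 => fun v =>
      tens (letter_elt (thead v)) (word_elt (behead_tuple v)) : tensor_bimodule _ _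
  end.

Lemma free_tpow n : free_right (tpow M n).
Proof.
have fM : free_right M by have [] := ss_covering M.
elim: n => [|n IHn] b g /=; first by move=> bg; apply: (mulgI b); rewrite mulg1.
rewrite (tensE b) tensor_ractE => /tens_eqP[k [/esym/fM->]].
by rewrite lact1; exact: IHn.
Qed.

Lemma basis_word n : is_basis (@word_elt n).
Proof.
have fM : free_right M by have [] := ss_covering M.
elim: n => [|n IHn] b.
  exists [tuple]; split; last by move=> v _; rewrite [v]tuple0.
  by exists b; rewrite /= mul1g.
rewrite (tensE b); move: (repr b) => [m c] /= {b}.
have [x [[k mE] _]] := ss_basis m; have [v [[h cE] _]] := IHn (lact k c).
have bE : tens m c = tens (letter_elt x) (ract (word_elt v) h).
  by rewrite -cE; apply/esym/tens_eqP; exists k.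
exists [tuple of x :: v]; split.
  exists h; rewrite bE tensor_ractE theadE.
  by congr (tens _ (ract (word_elt _) _)); exact: val_inj.
move=> w [h']; rewrite bE tensor_ractE => /tens_eqP[l [xw vw]].
have wx := is_basis_inj (@ss_basis M) xw.
move: xw; rewrite wx => /esym/fM l1; move: vw; rewrite l1 lact1 => vw.
have wv : behead_tuple w = v.
  apply: (@is_basis_inj _ _ _ _ _ (h * h'^-1)%g IHn).
  by rewrite ractM vw -ractM mulgV ract1.
by rewrite (tuple_eta w) wx; apply: val_inj; rewrite /= -wv.
Qed.

Fact coord_subproof n (b : tpow M n) :
  exists p : n.-tuple X * G, b = ract (word_elt p.1) p.2.
Proof. by have [v [[h bE] _]] := basis_word b; exists (v, h). Qed.

(* coord b = (v, h) when b = v.h with v a word of length n. *)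
Definition coord n (b : tpow M n) : n.-tuple X * G :=
  projT1 (cid (coord_subproof b)).

Lemma coordK n (b : tpow M n) : ract (word_elt (coord b).1) (coord b).2 = b.
Proof. by rewrite /coord; case: cid. Qed.

Lemma coordE n (v : n.-tuple X) h : coord (ract (word_elt v) h) = (v, h).
Proof.
have := coordK (ract (word_elt v) h); case: (coord _) => w k /= wv.
have E : w = v.
  apply: (is_basis_inj (g := (h * k^-1)%g) (@basis_word n)).
  by rewrite ractM -wv -ractM mulgV ract1.
by move: wv; rewrite E => /(ract_inj (@free_tpow n)) ->.
Qed.

Lemma coord_ract n (b : tpow M n) h :
  coord (ract b h) = ((coord b).1, (coord b).2 * h)%g.
Proof. by rewrite -{1}(coordK b) -ractM coordE. Qed.

(* g.v = g(v).g|_v with word_act g v = g(v) and section v g = g|_v. *)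
Definition word_act n (g : G) (v : n.-tuple X) : n.-tuple X :=
  (coord (lact g (word_elt v))).1.

Definition section n (v : n.-tuple X) (g : G) : G :=
  (coord (lact g (word_elt v))).2.

Lemma lact_word n g (v : n.-tuple X) :
  lact g (word_elt v) = ract (word_elt (word_act g v)) (section v g).
Proof. by rewrite coordK. Qed.

Lemma lact_word_inj n g (v w : n.-tuple X) h :
  lact g (word_elt v) = ract (word_elt w) h -> word_act g v = w /\ section v g = h.
Proof. by rewrite /word_act /section => ->; rewrite coordE. Qed.

Lemma lactMsection n g h (v : n.-tuple X) :
  word_act (g * h)%g v = word_act g (word_act h v) /\
  section v (g * h)%g = (section (word_act h v) g * section v h)%g.
Proof.
by apply: lact_word_inj; rewrite lactM lact_word lractA lact_word -ractM.
Qed.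

Definition word_actM n g h v := proj1 (@lactMsection n g h v).
Definition sectionM n g h v := proj2 (@lactMsection n g h v).

Lemma section1 n (v : n.-tuple X) : section v 1%g = 1%g.
Proof. by apply: proj2 (@lact_word_inj _ _ v v _ _); rewrite lact1 ract1. Qed.

Lemma sectionV n (v : n.-tuple X) g h :
  (section v g * (section v h)^-1 = section (word_act h v) (g * h^-1))%g.
Proof. by rewrite -{1}[g](mulgVK h) sectionM mulgK. Qed.

Lemma word_elt_cons n x (v : n.-tuple X) :
  word_elt [tuple of x :: v] = tens (letter_elt x) (word_elt v) :> tensor _ _.
Proof. by rewrite /= theadE; congr (tens _ (word_elt _)); exact: val_inj. Qed.

Lemma section_cons n (v : n.-tuple X) g x y h :
  lact g (letter_elt x) = ract (letter_elt y) h ->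
  word_act g [tuple of x :: v] = [tuple of y :: word_act h v] /\
  section [tuple of x :: v] g = section v h.
Proof.
move=> gx; apply: lact_word_inj; rewrite !word_elt_cons /= tensor_lactE gx.
rewrite tensor_ractE -lact_word; apply/esym/tens_eqP.
by exists h.
Qed.

Lemma section_cat m n (u : m.-tuple X) (v : n.-tuple X) g :
  word_act g [tuple of u ++ v] =
    [tuple of word_act g u ++ word_act (section u g) v] /\
  section [tuple of u ++ v] g = section v (section u g).
Proof.
elim: m u g => [|m IHm] u g.
  have [] : word_act g u = [tuple] /\ section u g = g.
    apply: lact_word_inj; rewrite /= mul1g mulg1 //.
  rewrite [u]tuple0 => -> ->.
  have -> : [tuple of [tuple] ++ v] = v by exact: val_inj.
  by split=> //; exact: val_inj.
case/tupleP: u => x w.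
have [y [[h gx] _]] := ss_basis (lact g (letter_elt x)).
have [-> ->] := section_cons w gx.
have [ga gs] := section_cons [tuple of w ++ v] gx.
have [ha hs] := IHm w h.
have -> : [tuple of [tuple of x :: w] ++ v] = [tuple of x :: [tuple of w ++ v]].
  exact: val_inj.
by rewrite ga gs ha hs; split=> //; exact: val_inj.
Qed.

(* The sets N such that g|_v lies in N for all sufficiently long words v. *)
Definition absorbing (N : set G) : Prop :=
  finite_set N /\
  forall g : G, exists n0 : nat, forall n (v : n.-tuple X),
    (n0 <= n)%N -> N (section v g).

Definition contracting_group : Prop := exists N, absorbing N.

(* The smallest absorbing set, provided that there is one: see nucleus_absorbing. *)
Definition nucleus : set G := \bigcap_(N in absorbing) N.

End SelfSimilar.
End Bimodules.

Section Nucleus.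
Variables (G : groupType) (M : self_similar G).

Lemma absorbingI (N N' : set G) :
  absorbing M N -> absorbing M N' -> absorbing M (N `&` N').
Proof.
move=> [fN aN] [_ aN']; split; first exact: finite_setIl.
move=> g; have [n0 h0] := aN g; have [n1 h1] := aN' g.
exists (maxn n0 n1) => n v; rewrite geq_max => /andP[n0n n1n].
by split; [exact: h0|exact: h1].
Qed.

Lemma nucleus_absorbing : contracting_group M -> absorbing M (nucleus M).
Proof.
move=> [N]; have [n] := ubnP #|` fset_set N|; elim: n N => // n IHn N.
rewrite ltnS => cN aN; have [H|] := pselect (forall N', absorbing M N' -> N `<=` N').
  suff -> : nucleus M = N by [].
  by apply/seteqP; split=> g Ng; [exact: Ng|move=> N' /H; exact].
move=> /existsNP[N' /not_implyP[aN' NN']].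
apply: (IHn (N `&` N')); last exact: absorbingI.
apply: leq_trans cN; apply: fproper_ltn_card.
have fN := aN.1; have fI : finite_set (N `&` N') by exact: finite_setIl.
rewrite fproperEneq; apply/andP; split; last first.
  by rewrite -fset_set_sub //; exact: subIsetl.
apply/eqP => /(fset_set_inj fI fN) E.
by apply: NN'; rewrite -E; exact: subIsetr.
Qed.

Lemma nucleus_section n (v : n.-tuple (letter M)) g :
  nucleus M g -> nucleus M (section v g).
Proof.
move=> Ng N aN; pose N' := [set h | N h /\ N (section v h)].
suff aN' : absorbing M N' by have [] := Ng _ aN'.
split; first by apply: sub_finite_set aN.1 => h [].
move=> h; have [n0 h0] := aN.2 h; exists n0 => m u n0m; split; first exact: h0.
have [_ <-] := section_cat u v h.
by apply: h0; exact: leq_trans (leq_addr _ _).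
Qed.

End Nucleus.

Record simplicial_complex (V : choiceType) := SimplicialComplex {
  simplex :> {fset V} -> Prop;
  simplex_neq0 : forall A, simplex A -> A != fset0;
  simplex_face : forall A B,
    simplex B -> (A `<=` B)%fset -> A != fset0 -> simplex A }.

Definition simplicial (V W : choiceType) (K : simplicial_complex V)
    (L : simplicial_complex W) (f : V -> W) : Prop :=
  forall A, K A -> L (f @` A)%fset.

Section Pushforward.
Variable R : realType.

Definition push (V W : choiceType) (f : V -> W) (w : {fsfun V -> R with 0}) :
    {fsfun W -> R with 0} :=
  [fsfun y in (f @` finsupp w)%fset => \sum_(v <- finsupp w | f v == y) w v].

Lemma pushE (V W : choiceType) (f : V -> W) w y :
  push f w y = \sum_(v <- finsupp w | f v == y) w v.
Proof.
rewrite fsfunE; case: ifPn => // /imfsetP yf; rewrite big_seq_cond big_pred0//.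
by move=> v; apply/negP => /andP[vw /eqP fv]; apply: yf; exists v.
Qed.


Lemma push_ge0 (V W : choiceType) (f : V -> W) (w : {fsfun V -> R with 0}) y :
  (forall v, 0 <= w v) -> 0 <= push f w y.
Proof. by move=> w0; rewrite pushE; exact: sumr_ge0. Qed.

Lemma finsupp_push (V W : choiceType) (f : V -> W) (w : {fsfun V -> R with 0}) :
  (forall v, 0 <= w v) -> finsupp (push f w) = (f @` finsupp w)%fset.
Proof.
move=> w0; apply/fsetP => y; rewrite mem_finsupp pushE psumr_neq0//.
apply/hasP/imfsetP => [[v vw /andP[/eqP fv _]]|[v /= vw ->]]; exists v => //=.
by rewrite eqxx lt_neqAle w0 eq_sym -mem_finsupp vw.
Qed.

Lemma sum_push (V W : choiceType) (f : V -> W) (w : {fsfun V -> R with 0}) :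
  (forall v, 0 <= w v) ->
  \sum_(y <- finsupp (push f w)) push f w y = \sum_(v <- finsupp w) w v.
Proof.
move=> w0; rewrite finsupp_push// (partition_big_imfset _ f).
by apply: eq_bigr => y _; rewrite pushE.
Qed.

Lemma push_comp (U V W : choiceType) (f : V -> W) (g : U -> V)
    (w : {fsfun U -> R with 0}) :
  (forall v, 0 <= w v) -> push f (push g w) = push (f \o g) w.
Proof.
move=> w0; apply/fsfunP => y; rewrite !pushE finsupp_push//.
transitivity (\sum_(v <- (g @` finsupp w)%fset | f v == y)
                \sum_(u <- finsupp w | g u == v) w u).
  by apply: eq_bigr => v _; rewrite pushE.
rewrite [RHS]big_mkcond (partition_big_imfset _ g) big_mkcond.
apply: eq_bigr => v _; case: ifPn => fv.
  by apply: eq_bigr => u /eqP gu; rewrite /= gu fv.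
by rewrite big1// => u /eqP gu; rewrite /= gu (negPf fv).
Qed.

Lemma push_id (V : choiceType) (f : V -> V) (w : {fsfun V -> R with 0}) :
  {in finsupp w, forall v, f v = v} -> push f w = w.
Proof.
move=> fid; apply/fsfunP => y; rewrite pushE big_seq_cond.
have [yw|yw] := finsuppP w y.
  rewrite big1// => v /andP[vw /eqP]; rewrite fid// => vy.
  by rewrite -vy vw in yw.
rewrite (eq_bigl (fun v => (v \in finsupp w) && (v == y))); last first.
  by move=> v; case vw : (v \in _) => //=; rewrite fid.
rewrite -big_seq_cond big_mkcond (big_fsetD1 y)//= eqxx big_seq big1 ?addr0// => v.
by rewrite !inE => /andP[/negPf->].
Qed.

Lemma eq_push (V W : choiceType) (f g : V -> W) (w : {fsfun V -> R with 0}) :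
  {in finsupp w, f =1 g} -> push f w = push g w.
Proof.
move=> fg; apply/fsfunP => y; rewrite !pushE big_seq_cond [RHS]big_seq_cond.
by apply: eq_bigl => v; case vw : (v \in _) => //=; rewrite fg.
Qed.

End Pushforward.

Section Realization.
Variables (R : realType) (V : choiceType) (K : simplicial_complex V).

(* Points are given by their barycentric coordinates. *)
Definition is_point (w : {fsfun V -> R with 0}) : Prop :=
  [/\ K (finsupp w), forall v, 0 <= w v & \sum_(v <- finsupp w) w v = 1].

Record realization := Point {
  weight :> {fsfun V -> R with 0};
  weightP : `[< is_point weight >] }.

HB.instance Definition _ := [isSub for weight].
HB.instance Definition _ := [Choice of realization by <:].

Lemma realizationP (x : realization) : is_point x.
Proof. exact/asboolP/weightP. Qed.

Lemma weight_ge0 (x : realization) v : 0 <= x v.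
Proof. by have [] := realizationP x. Qed.

Definition in_common_simplex (x y : realization) : Prop :=
  exists A, [/\ K A, (finsupp x `<=` A)%fset & (finsupp y `<=` A)%fset].

(* The factor 1/2 gives the edges unit length: distinct vertices are at distance
   sqrt 2 for the l2 norm of the barycentric coordinates. *)
Definition eucl (x y : realization) : R :=
  Num.sqrt (2^-1 * \sum_(v <- (finsupp x `|` finsupp y)%fset) (x v - y v) ^+ 2).

(* string x y l: there is a broken line of length l from x to y, each of whose
   segments lies in a simplex of K. *)
Inductive string : realization -> realization -> R -> Prop :=
  | string0 x : string x x 0
  | string_cons x y z l :
      in_common_simplex x y -> string y z l -> string x z (eucl x y + l).

(* The length metric; it is +oo between distinct connected components. *)
Definition dist (x y : realization) : \bar R :=
  ereal_inf [set l%:E | l in string x y].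

Lemma euclC x y : eucl x y = eucl y x.
Proof.
rewrite /eucl fsetUC; congr (Num.sqrt (_ * _)); apply: eq_bigr => v _.
by rewrite -sqrrN opprB.
Qed.

Lemma string_cat x y z l l' :
  string x y l -> string y z l' -> string x z (l + l').
Proof.
elim=> [u|u v t m uv _ IH] tz; first by rewrite add0r.
by rewrite -addrA; apply: string_cons uv (IH tz).
Qed.

Lemma string_sym x y l : string x y l -> string y x l.
Proof.
elim=> [u|u v t m [A [KA uA vA]] _ IH]; first exact: string0.
rewrite addrC; apply: string_cat IH _; rewrite euclC -[X in string _ _ X]addr0.
by apply: string_cons (string0 _); exists A.
Qed.

Lemma string_ge0 x y l : string x y l -> 0 <= l.
Proof. by elim=> // u v t m _ _ m0; rewrite addr_ge0// sqrtr_ge0. Qed.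

Definition dist_ball (x : realization) (e : R) : set realization :=
  [set y | (dist x y < e%:E)%E].

Lemma dist_ballP x e y : dist_ball x e y <-> exists2 l, string x y l & l < e.
Proof.
split=> [/ereal_inf_lt[_ [l xyl <-]]|[l xyl le]]; first by rewrite lte_fin; exists l.
apply: (@le_lt_trans _ _ l%:E); last by rewrite lte_fin.
by apply: ereal_inf_lbound; exists l.
Qed.

Fact dist_ball_center x (e : R) : 0 < e -> dist_ball x e x.
Proof. by move=> e0; apply/dist_ballP; exists 0 => //; exact: string0. Qed.

Fact dist_ball_sym x y (e : R) : dist_ball x e y -> dist_ball y e x.
Proof.
by move=> /dist_ballP[l /string_sym xy le]; apply/dist_ballP; exists l.
Qed.

Fact dist_ball_triangle x y z (e1 e2 : R) :
  dist_ball x e1 y -> dist_ball y e2 z -> dist_ball x (e1 + e2) z.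
Proof.
move=> /dist_ballP[l xy le] /dist_ballP[l' yz le']; apply/dist_ballP.
by exists (l + l'); [exact: string_cat yz|exact: ltrD].
Qed.

HB.instance Definition _ := hasNbhs.Build realization
  (nbhs_ (entourage_ dist_ball)).
HB.instance Definition _ := Nbhs_isPseudoMetric.Build R realization
  erefl dist_ball_center dist_ball_sym dist_ball_triangle erefl.

End Realization.

Section Realize.
Variables (R : realType) (V W : choiceType).
Variables (K : simplicial_complex V) (L : simplicial_complex W).

Fact realize_subproof (f : V -> W) (sf : simplicial K L f) (x : realization R K) :
  `[< is_point L (push f x) >].
Proof.
apply/asboolP; have [Kx x0 x1] := realizationP x; split.
- by rewrite finsupp_push//; exact: sf.
- by move=> y; exact: push_ge0.
- by rewrite sum_push.
Qed.

Definition realize (f : V -> W) (sf : simplicial K L f) (x : realization R K) :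
  realization R L := Point (realize_subproof sf x).

End Realize.

Section SelfSimilarComplexes.
Variables (G : groupType) (M : self_similar G).

(* A complex with vertices in G, invariant under right translations and under
   the maps g |-> g|_v; both Gamma(G, N) and the tiling nerve are such. *)
Record ss_complex := SSComplex {
  ss_cplx :> simplicial_complex G;
  ss_ract : forall h : G, simplicial ss_cplx ss_cplx (fun g => g * h)%g;
  ss_section : forall n (v : n.-tuple (letter M)),
    simplicial ss_cplx ss_cplx (section v) }.

Section Action.
Variables (R : realType) (K : ss_complex).

Definition real_ract (x : realization R K) (h : G) : realization R K :=
  realize (@ss_ract K h) x.

Fact real_ract1 x : real_ract x 1%g = x.
Proof. by apply: val_inj; apply: push_id => g _; rewrite mulg1. Qed.

Fact real_ractM x g h : real_ract x (g * h)%g = real_ract (real_ract x g) h.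
Proof.
apply: val_inj; rewrite /= push_comp; last exact: weight_ge0.
by apply: eq_push => k _; rewrite /= mulgA.
Qed.

Definition real_rset : rset G := RSet real_ract1 real_ractM.

Definition Iword n (v : n.-tuple (letter M)) (x : realization R K) :
  realization R K := realize (@ss_section K n v) x.

(* I^(n)(x (x) v.h) = I_v(x).h: see ImapE. *)
Definition Imap n (t : tensor real_rset (tpow M n)) : real_rset :=
  ract (Iword (coord (repr t).2).1 (repr t).1 : real_rset) (coord (repr t).2).2.

Lemma Iword_ract n (v : n.-tuple (letter M)) x g :
  Iword v (real_ract x g) = real_ract (Iword (word_act g v) x) (section v g).
Proof.
apply: val_inj; rewrite /= !push_comp; try exact: weight_ge0.
by apply: eq_push => k _; rewrite /= sectionM.
Qed.

Lemma ImapE n (x : real_rset) (v : n.-tuple (letter M)) h :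
  Imap (tens x (ract (word_elt v) h)) = ract (Iword v x : real_rset) h.
Proof.
rewrite /Imap; set t := tens _ _; have := tensE t; rewrite {1}/t.
move: (repr t) => [y c] /= /tens_eqP[g [-> vh]].
have := congr1 (@coord _ _ n) vh; rewrite coordE -{1}(coordK c) lractA.
rewrite lact_word -ractM coordE => -[-> ->].
by rewrite Iword_ract real_ractM.
Qed.

Lemma Imap_equivariant n :
  equivariant (S := tensor_rset real_rset (tpow M n)) (@Imap n).
Proof.
move=> t h; rewrite (tensE t); move: (repr t) => [x b] /=.
by rewrite tensor_ractE -(coordK b) -ractM !ImapE ractM.
Qed.

End Action.

Fact nucleus_simplex_neq0 (A : {fset G}) :
  A != fset0 /\ (forall g h, g \in A -> h \in A -> nucleus M (g * h^-1)%g) ->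
  A != fset0.
Proof. by case. Qed.

Fact nucleus_simplex_face (A B : {fset G}) :
  B != fset0 /\ (forall g h, g \in B -> h \in B -> nucleus M (g * h^-1)%g) ->
  (A `<=` B)%fset -> A != fset0 ->
  A != fset0 /\ (forall g h, g \in A -> h \in A -> nucleus M (g * h^-1)%g).
Proof.
by move=> [_ NB] /fsubsetP AB A0; split=> // g h /AB gB /AB; exact: NB.
Qed.

(* Gamma(G, N), for N the nucleus. *)
Definition nucleus_complex : simplicial_complex G :=
  SimplicialComplex nucleus_simplex_neq0 nucleus_simplex_face.

Lemma imfset_neq0 (T U : choiceType) (f : T -> U) (A : {fset T}) :
  A != fset0 -> (f @` A)%fset != fset0.
Proof.
by move=> /fset0Pn[x xA]; apply/fset0Pn; exists (f x); apply/imfsetP; exists x.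
Qed.

Fact nucleus_complex_ract (h : G) :
  simplicial nucleus_complex nucleus_complex (fun g => g * h)%g.
Proof.
move=> A [A0 NA]; split; first exact: imfset_neq0.
move=> _ _ /imfsetP[a /= aA ->] /imfsetP[b /= bA ->].
by rewrite invgM mulgA mulgK; exact: NA.
Qed.

Fact nucleus_complex_section n (v : n.-tuple (letter M)) :
  simplicial nucleus_complex nucleus_complex (section v).
Proof.
move=> A [A0 NA]; split; first exact: imfset_neq0.
move=> _ _ /imfsetP[a /= aA ->] /imfsetP[b /= bA ->].
by rewrite sectionV; apply: nucleus_section; exact: NA.
Qed.

Definition nucleus_ss_complex : ss_complex :=
  SSComplex nucleus_complex_ract nucleus_complex_section.

(* The simplices of the subcomplex I^(n)(Gamma(G, N) (x) M^(n)). *)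
Definition image_simplex (n : nat) (A : {fset G}) : Prop :=
  exists (v : n.-tuple (letter M)) (h : G) (B : {fset G}),
    nucleus_complex B /\ A = [fset (section v g * h)%g | g in B]%fset.

Definition tiling_simplex (A : {fset G}) : Prop := forall n, image_simplex n A.

Fact tiling_simplex_neq0 A : tiling_simplex A -> A != fset0.
Proof. by move=> /(_ 0%N)[v [h [B [[B0 _] ->]]]]; exact: imfset_neq0. Qed.

Fact tiling_simplex_face A B :
  tiling_simplex B -> (A `<=` B)%fset -> A != fset0 -> tiling_simplex A.
Proof.
move=> TB AB A0 n; have [v [h [C [KC BE]]]] := TB n.
pose D := [fset g in C | (section v g * h)%g \in A]%fset.
have AE : A = [fset (section v g * h)%g | g in D]%fset.
  apply/fsetP => a; apply/idP/imfsetP => [aA|[g /= gD ->]]; last first.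
    by move: gD; rewrite !inE => /andP[].
  move/fsubsetP: AB => /(_ _ aA); rewrite BE => /imfsetP[g /= gC aE].
  by exists g => //=; rewrite !inE gC -aE.
exists v, h, D; split=> //; apply: simplex_face KC _ _.
  by apply/fsubsetP => g; rewrite !inE => /andP[].
apply: contra_neq A0 => D0; rewrite AE D0.
by apply/fsetP => a; apply/imfsetP; rewrite inE => -[].
Qed.

Definition tiling_complex : simplicial_complex G :=
  SimplicialComplex tiling_simplex_neq0 tiling_simplex_face.

Lemma imfset_comp (T U W : choiceType) (f : U -> W) (g : T -> U) (A : {fset T}) :
  (f @` (g @` A))%fset = [fset f (g x) | x in A]%fset.
Proof.
apply/fsetP => y; apply/imfsetP/imfsetP => [[_ /imfsetP[x xA ->] ->]|[x xA ->]].
  by exists x.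
by exists (g x) => //; apply/imfsetP; exists x.
Qed.

Lemma eq_imfset_fun (T U : choiceType) (f g : T -> U) (A : {fset T}) :
  f =1 g -> (f @` A)%fset = (g @` A)%fset.
Proof. by move=> fg; apply/fsetP => y; apply/imfsetP/imfsetP => -[x xA ->]; exists x. Qed.

Fact tiling_complex_ract (h : G) :
  simplicial tiling_complex tiling_complex (fun g => g * h)%g.
Proof.
move=> A TA n; have [v [k [B [KB ->]]]] := TA n.
exists v, (k * h)%g, B; split=> //; rewrite imfset_comp.
by apply: eq_imfset_fun => g; rewrite mulgA.
Qed.

Lemma tuple_cat m n (v : (m + n).-tuple (letter M)) :
  exists (u : m.-tuple (letter M)) (w : n.-tuple (letter M)),
    v = [tuple of u ++ w].
Proof.
have su : size (take m v) == m by rewrite size_takel ?size_tuple ?leq_addr.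
have sw : size (drop m v) == n by rewrite size_drop size_tuple addKn.
exists (Tuple su), (Tuple sw); apply: val_inj; exact/esym/cat_take_drop.
Qed.

Fact tiling_complex_section n (v : n.-tuple (letter M)) :
  simplicial tiling_complex tiling_complex (section v).
Proof.
move=> A TA m; case: (leqP m n) => [mn|/ltnW nm].
  move: v; rewrite -(subnK mn) => v; have [u [w ->]] := tuple_cat v.
  have [v0 [k [B [KB AE]]]] := TA 0%N.
  have KA := @nucleus_complex_ract k _ (nucleus_complex_section v0 KB).
  rewrite imfset_comp -AE in KA.
  exists w, 1%g, (section u @` A)%fset; split; first exact: nucleus_complex_section.
  rewrite imfset_comp; apply: eq_imfset_fun => g.
  by rewrite (section_cat u w g).2 mulg1.
rewrite -(subnK nm); move: (m - n)%N => d; have [u [k [B [KB ->]]]] := TA d.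
exists [tuple of u ++ word_act k v], (section v k), B; split=> //.
rewrite imfset_comp; apply: eq_imfset_fun => g.
by rewrite sectionM (section_cat _ _ g).2.
Qed.

Definition tiling_nerve : ss_complex :=
  SSComplex tiling_complex_ract tiling_complex_section.

(* As a set of points, the tiling nerve is the intersection of the images of the
   maps I^(n) on Gamma(G, N) (x) M^(n). *)
Lemma tiling_nerveP (R : realType) (x : realization R nucleus_ss_complex) :
  tiling_nerve (finsupp x) <->
  (forall n, exists t : tensor (real_rset R nucleus_ss_complex) (tpow M n),
    Imap t = x).
Proof.
split=> [Tx n|H n]; last first.
  have [t <-] := H n; rewrite (tensE t) -(coordK (repr t).2) ImapE.
  set v := (coord _).1; set h := (coord _).2; set y := (repr t).1.
  exists v, h, (finsupp y); split; first by have [] := realizationP y.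
  rewrite finsupp_push; last exact: weight_ge0.
  by rewrite finsupp_push ?imfset_comp//; exact: weight_ge0.
have [v [h [B [KB xE]]]] := Tx n.
pose f g := (section v g * h)%g.
have /choice[s sP] : forall a, exists g, a \in finsupp x -> g \in B /\ f g = a.
  move=> a; have [|ax] := boolP (a \in finsupp x); last by exists a.
  by rewrite {1}xE => /imfsetP[g /= gB aE]; exists g.
have x0 := weight_ge0 x; have [Kx _ x1] := realizationP x.
have yP : `[< is_point nucleus_ss_complex (push s x) >].
  apply/asboolP; split; last by rewrite sum_push.
    rewrite finsupp_push//; apply: simplex_face KB _ _.
      by apply/fsubsetP => _ /imfsetP[a /= ax ->]; have [] := sP a ax.
    by apply: imfset_neq0; exact: simplex_neq0 Kx.
  by move=> g; exact: push_ge0.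
exists (tens (Point yP : real_rset R nucleus_ss_complex) (ract (word_elt v) h)).
have y0 g : 0 <= push s x g by exact: push_ge0.
rewrite ImapE; apply: val_inj; rewrite /= !push_comp//.
by apply: push_id => a ax; exact: (sP a ax).2.
Qed.

Section Homotopy.
Variables (R : realType) (K : ss_complex) (B : bimodule G).

Let S : rset G := real_rset R K.

(* B carries the discrete topology, and the tensor product the quotient topology
   of the product. *)
Definition tensor_space : topologicalType :=
  quotient_topology
    (tensor S B : quotType (realization R K * discrete_topology B)%type).

(* The parameter of the homotopy ranges over [0, 1]. *)
Definition equivariantly_homotopic (Phi Psi : tensor_space -> realization R K) :
    Prop :=
  exists H : R * tensor_space -> realization R K,
    [/\ {within `[0, 1]%classic `*` setT, continuous H},
        forall s, 0 <= s <= 1 ->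
          equivariant (S := tensor_rset S B) (T := S) (fun t => H (s, t)),
        forall t, H (0, t) = Phi t
      & forall t, H (1, t) = Psi t].

(* Psi^(k)(x (x) b1 (x) ... (x) bk); every element of B^(k) is a pure tensor
   b1 (x) ... (x) bk, so w ranges over sequences of length k below. *)
Definition iter_tensor (Psi : tensor_space -> realization R K)
    (x : realization R K) (w : seq B) : realization R K :=
  foldl (fun y b => Psi (tens (y : S) b)) x w.

Definition contracting_map (Psi : tensor_space -> realization R K) : Prop :=
  [/\ continuous Psi,
      equivariant (S := tensor_rset S B) (T := S) Psi
    & exists (k : nat) (lambda : R),
      [/\ (1 <= k)%N, 0 < lambda < 1
        & forall (x y : realization R K) (w : k.-tuple B),
            (dist (iter_tensor Psi x w) (iter_tensor Psi y w)
              <= lambda%:E * dist x y)%E]].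

End Homotopy.
End SelfSimilarComplexes.

(* Main.v *)
Require Import Defs.
From mathcomp Require Import all_boot all_order all_algebra finmap.
From mathcomp Require Import all_classical all_reals all_analysis.
From mathcomp Require Import lra.

(** The map I^(n) is simplicial, so it fails to contract only because it may
    send an edge onto an edge.  The remedy is to move a point of Gamma by one
    step of a random walk before I^(n) is applied.

    Let F be the nucleus together with 1.  For 0 <= s <= 1, the lazy step
    [lazy_step F s] replaces a vertex g by g itself with probability 1 - s and
    by a uniformly random element of F g with probability s.  It commutes with
    right translations, but it leaves Gamma: it maps a simplex A into the full
    simplex on the vertices F A.  If n is large then, whatever the simplex A, the maps
    g |-> g|_v with |v| = n send F A to a simplex of Gamma
    ([long_section_thick]).  Indeed, up to translation there are only finitely
    many sets A, so the quotients of elements of F A form a finite set, whose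
    sections at long words lie in the nucleus; moreover the decreasing sequence
    of images of the maps I^(n) is eventually constant, again because there are
    finitely many simplices up to translation ([tiling_simplex_stable]).  Hence
    the formula x (x) v.h |-> I_v (lazy_step F s x).h defines an equivariant
    homotopy [spread] from I^(n), at s = 0, to a map Psi, at s = 1.

    Distances inside a simplex are measured by the l1 norm of the barycentric
    coordinates, for which every affine map between simplices that sends vertices
    to points is 1-Lipschitz (this fails for the Euclidean norm).  If g0 is a
    vertex of a simplex A, then g0 lies in F g for all g in A, since
    g0 g^-1 is in the nucleus.  So the random steps from the vertices of A all
    have the mass 1/|F| at g0 in common, and the full step contracts the l1
    distance of points of A by the factor 1 - 1/|F| ([l1_lazy_step1], Doeblin's
    argument).  Simplices have at most |F| vertices, so inside a simplex the
    Euclidean and the l1 distances are comparable up to the factor 2|F|.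
    Applying this to the segments of broken lines shows that the k-th iterate of
    Psi is Lipschitz with constant (1 - 1/|F|)^k 2|F|, which is at most 1/2 for
    large k ([spread1_contracting]).

    The homotopy is continuous on the quotient because the projection of
    Gamma x M^(n) onto the tensor product is open ([nbhs_tens]). *)

Set Implicit Arguments.
Unset Strict Implicit.
Unset Printing Implicit Defensive.

Import Order.TTheory GRing.Theory Num.Theory.
Import numFieldNormedType.Exports.

Local Open Scope classical_set_scope.
Local Open Scope ring_scope.

(** * The l1 distance of barycentric coordinates *)

Section L1.
Variable R : realType.

Definition l1 (V : choiceType) (x y : {fsfun V -> R with 0}) : R :=
  \sum_(v <- (finsupp x `|` finsupp y)%fset) `|x v - y v|.

Lemma sum_supp_le (V : choiceType) (A S : {fset V}) (f : V -> R) :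
  (forall v, 0 <= f v) -> (forall v, v \notin A -> f v = 0) ->
  \sum_(v <- S) f v <= \sum_(v <- A) f v.
Proof.
move=> f0 fA.
rewrite (big_fset_incl _ (fsubsetUl A S)); last by move=> v _ /fA.
rewrite (big_fsetID _ (mem S) (A `|` S)%fset) /=.
have -> : [fset x | x in (A `|` S)%fset & x \in S]%fset = S.
  by apply/fsetP => v; rewrite !inE; case: (v \in S); rewrite ?orbT ?andbF.
by rewrite lerDl sumr_ge0.
Qed.

Lemma sum_suppE (V : choiceType) (A S : {fset V}) (f : V -> R) :
  (forall v, v \notin A -> f v = 0) -> (A `<=` S)%fset ->
  \sum_(v <- S) f v = \sum_(v <- A) f v.
Proof. by move=> fA AS; rewrite (big_fset_incl _ AS)// => v _ /fA. Qed.

Lemma l1E (V : choiceType) (x y : {fsfun V -> R with 0}) (S : {fset V}) :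
  (finsupp x `<=` S)%fset -> (finsupp y `<=` S)%fset ->
  l1 x y = \sum_(v <- S) `|x v - y v|.
Proof.
move=> xS yS; rewrite [RHS](@sum_suppE _ (finsupp x `|` finsupp y)%fset) //.
  move=> v; rewrite inE negb_or => /andP[vx vy].
  by rewrite (fsfun_dflt vx) (fsfun_dflt vy) subr0 normr0.
by rewrite fsubUset xS.
Qed.

Lemma l1_ge0 (V : choiceType) (x y : {fsfun V -> R with 0}) : 0 <= l1 x y.
Proof. exact: sumr_ge0. Qed.

(** Two points can be compared only after their push-forwards are written as
    sums over one and the same finite set. *)
Lemma push_sumE (V W : choiceType) (f : V -> W) (x : {fsfun V -> R with 0})
    (S : {fset V}) w :
  (finsupp x `<=` S)%fset -> push f x w = \sum_(v <- S | f v == w) x v.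
Proof.
move=> xS; rewrite pushE [RHS]big_mkcond (@sum_suppE _ (finsupp x)) //.
  by rewrite [LHS]big_mkcond.
by move=> v vx; rewrite (fsfun_dflt vx) if_same.
Qed.

Lemma finsupp_push_imfset (V W : choiceType) (f : V -> W)
    (x : {fsfun V -> R with 0}) (A : {fset V}) :
  (finsupp x `<=` A)%fset -> (finsupp (push f x) `<=` f @` A)%fset.
Proof.
move=> /fsubsetP xA; apply: fsubset_trans (finsupp_sub _ _ _) _.
apply/fsubsetP => w /imfsetP[v /= vx ->]; apply: in_imfset; exact: xA.
Qed.

Lemma l1_push (V W : choiceType) (f : V -> W) (x y : {fsfun V -> R with 0}) :
  l1 (push f x) (push f y) <= l1 x y.
Proof.
set S := (finsupp x `|` finsupp y)%fset.
have xS : (finsupp x `<=` S)%fset by exact: fsubsetUl.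
have yS : (finsupp y `<=` S)%fset by exact: fsubsetUr.
rewrite (l1E (finsupp_push_imfset f xS) (finsupp_push_imfset f yS)).
rewrite (l1E xS yS) (partition_big_imfset _ f); apply: ler_sum => w _.
by rewrite (push_sumE f w xS) (push_sumE f w yS) -sumrB; exact: ler_norm_sum.
Qed.

End L1.

Section NormComparison.
Variables (R : realType) (V : choiceType) (K : simplicial_complex V).

Lemma sumsq_le (I : Type) (r : seq I) (f : I -> R) :
  (forall i, 0 <= f i) -> \sum_(i <- r) f i ^+ 2 <= (\sum_(i <- r) f i) ^+ 2.
Proof.
move=> f0; elim: r => [|i r IH]; first by rewrite !big_nil expr0n.
have s0 : 0 <= \sum_(j <- r) f j by exact: sumr_ge0.
rewrite !big_cons sqrrD.
by rewrite -addrA lerD2l (le_trans IH)// lerDr mulrn_wge0// mulr_ge0.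
Qed.

(** The l2 norm is at most the l1 norm, and the factor 1/2 in [eucl] only helps. *)
Lemma eucl_le_l1 (x y : realization R K) : eucl x y <= l1 x y.
Proof.
rewrite -[leRHS](ger0_norm (l1_ge0 x y)) -sqrtr_sqr ler_wsqrtr//.
set s := \sum_(_ <- _) _; have s0 : 0 <= s by apply: sumr_ge0 => v _; exact: sqr_ge0.
suff : s <= l1 x y ^+ 2 by move: s0; lra.
apply: (@le_trans _ _ (\sum_(v <- (finsupp x `|` finsupp y)%fset) `|x v - y v| ^+ 2)).
  by apply: ler_sum => v _; rewrite real_normK// num_real.
exact: sumsq_le.
Qed.

Lemma l1_le_eucl (x y : realization R K) (A : {fset V}) :
  (finsupp x `<=` A)%fset -> (finsupp y `<=` A)%fset ->
  l1 x y <= 2 * #|` A|%:R * eucl x y.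
Proof.
move=> xA yA; rewrite (l1E xA yA).
(* A single coordinate is at most the l2 norm, which is sqrt 2 times [eucl]. *)
have coord_le v : `|x v - y v| <= 2 * eucl x y.
  rewrite -sqrtr_sqr -[leRHS](ger0_norm _) -?sqrtr_sqr ?mulr_ge0 ?sqrtr_ge0//.
  rewrite ler_wsqrtr// exprMn sqr_sqrtr; last first.
    by rewrite mulr_ge0 ?invr_ge0// sumr_ge0// => u _; exact: sqr_ge0.
  rewrite mulrA; set S := (_ `|` _)%fset; set c : R := 2 ^+ 2 / 2.
  have c1 : 1 <= c by rewrite /c; lra.
  have [vS|vS] := boolP (v \in S).
    have s0 : 0 <= \sum_(u <- (S `\ v)%fset) (x u - y u) ^+ 2.
      by apply: sumr_ge0 => u _; exact: sqr_ge0.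
    rewrite (big_fsetD1 v)//= (@le_trans _ _ (c * (x v - y v) ^+ 2))//.
      by rewrite ler_peMl// sqr_ge0.
    by rewrite ler_pM2l ?lerDl// (lt_le_trans ltr01).
  move: vS; rewrite inE negb_or => /andP[vx vy].
  rewrite (fsfun_dflt vx) (fsfun_dflt vy) subr0 expr0n mulr_ge0//.
    exact: le_trans c1.
  by apply: sumr_ge0 => u _; exact: sqr_ge0.
apply: le_trans (ler_sum _ (fun v _ => coord_le v)) _.
rewrite big_const_seq count_predT iter_addr_0 -[leLHS]mulr_natr.
by rewrite mulrAC.
Qed.

End NormComparison.

Lemma realize_common_simplex (R : realType) (V W : choiceType)
    (K : simplicial_complex V) (L : simplicial_complex W) (f : V -> W)
    (fKL : simplicial K L f) (x y : realization R K) :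
  in_common_simplex x y -> in_common_simplex (realize fKL x) (realize fKL y).
Proof.
move=> [A [KA xA yA]]; exists (f @` A)%fset; split; first exact: fKL.
  exact: finsupp_push_imfset.
exact: finsupp_push_imfset.
Qed.

(** * The lazy random walk on a group *)

Lemma push_inj (R : realType) (V W : choiceType) (f : V -> W)
    (x : {fsfun V -> R with 0}) v :
  injective f -> push f x (f v) = x v.
Proof.
move=> fI; rewrite (push_sumE f (f v) (fsubsetUl (finsupp x) [fset v]%fset)).
by rewrite fbig_pred1_inj// !inE eqxx orbT.
Qed.

Section LazyWalk.
Variables (R : realType) (G : groupType) (F : {fset G}).
Hypothesis F1 : 1%g \in F.
Implicit Types (s : R) (x : {fsfun G -> R with 0}).

Definition thicken (A : {fset G}) : {fset G} :=
  [fset (b * g)%g | b in F, g in A]%fset.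

Lemma mem_thicken (A : {fset G}) b g :
  b \in F -> g \in A -> (b * g)%g \in thicken A.
Proof. by move=> bF gA; apply/imfset2P; exists b => //; exists g. Qed.

Lemma sub_thicken (A : {fset G}) : (A `<=` thicken A)%fset.
Proof. by apply/fsubsetP => g gA; rewrite -[g]mul1g; exact: mem_thicken. Qed.

Lemma thickenS (A B : {fset G}) :
  (A `<=` B)%fset -> (thicken A `<=` thicken B)%fset.
Proof.
move=> /fsubsetP AB; apply/fsubsetP => _ /imfset2P[b /= bF [g /= gA ->]].
by apply: mem_thicken => //; exact: AB.
Qed.

Let c : R := #|` F|%:R^-1.

Let c_ge0 : 0 <= c. Proof. by rewrite invr_ge0. Qed.

Let cF : c * #|` F|%:R = 1.
Proof. by rewrite mulVf// pnatr_eq0 cardfs_eq0; apply/fset0Pn; exists 1%g. Qed.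

(** The law, after one step, of the walk that starts at a random point of law x,
    stays put with probability 1 - s, and otherwise is multiplied on the left by
    a uniform element of F. *)
Definition lazy_step (s : R) (x : {fsfun G -> R with 0}) :
    {fsfun G -> R with 0} :=
  [fsfun z in thicken (finsupp x) =>
     (1 - s) * x z + s * (#|` F|%:R^-1 * \sum_(b <- F) x (b^-1 * z)%g)].

Lemma lazy_stepE s x z :
  lazy_step s x z = (1 - s) * x z + s * (c * \sum_(b <- F) x (b^-1 * z)%g).
Proof.
rewrite fsfunE; case: ifPn => // zN.
rewrite (fsfun_dflt (contra (fsubsetP (sub_thicken _) z) zN)) mulr0 add0r.
rewrite big_seq big1 ?mulr0// => b bF; apply/fsfun_dflt/(contra _ zN) => bz.
by rewrite -[z](mulVKg b); exact: mem_thicken.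
Qed.

Lemma finsupp_lazy_step s x :
  (finsupp (lazy_step s x) `<=` thicken (finsupp x))%fset.
Proof. exact: finsupp_sub. Qed.

Lemma lazy_step_ge0 s x z :
  0 <= s <= 1 -> (forall v, 0 <= x v) -> 0 <= lazy_step s x z.
Proof.
move=> /andP[s0 s1] x0; rewrite lazy_stepE addr_ge0// mulr_ge0// ?subr_ge0//.
by rewrite mulr_ge0// sumr_ge0.
Qed.

Lemma lazy_step0 x : lazy_step 0 x = x.
Proof. by apply/fsfunP => z; rewrite lazy_stepE subr0 mul1r mul0r addr0. Qed.

(** The walk multiplies on the left, hence commutes with right translations. *)
Lemma lazy_step_push_mulr s x h :
  lazy_step s (push (fun g => g * h)%g x) = push (fun g => g * h)%g (lazy_step s x).
Proof.
have pE (y : {fsfun G -> R with 0}) z :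
    push (fun g => g * h)%g y z = y (z * h^-1)%g.
  by rewrite -{1}[z](mulgVK h); apply: push_inj; exact: mulIg.
apply/fsfunP => z; rewrite pE !lazy_stepE pE; congr (_ + _ * (_ * _)).
by apply: eq_bigr => b _; rewrite pE mulgA.
Qed.

Section Sums.
Variables (A S : {fset G}) (f : G -> R).
Hypothesis fA : forall v, v \notin A -> f v = 0.

Lemma sum_translate_le b : (forall v, 0 <= f v) ->
  \sum_(z <- S) f (b^-1 * z)%g <= \sum_(v <- A) f v.
Proof.
move=> f0; have -> : \sum_(z <- S) f (b^-1 * z)%g =
    \sum_(u <- [fset (b^-1 * z)%g | z in S]%fset) f u.
  by rewrite big_imfset//= => u v _ _ /mulgI.
exact: sum_supp_le.
Qed.

Lemma sum_translate b : (forall g, g \in A -> (b * g)%g \in S) ->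
  \sum_(z <- S) f (b^-1 * z)%g = \sum_(v <- A) f v.
Proof.
move=> bA; have -> : \sum_(z <- S) f (b^-1 * z)%g =
    \sum_(u <- [fset (b^-1 * z)%g | z in S]%fset) f u.
  by rewrite big_imfset//= => u v _ _ /mulgI.
apply: sum_suppE => //; apply/fsubsetP => g gA; apply/imfsetP.
by exists (b * g)%g; [exact: bA|rewrite mulKg].
Qed.

(** Every vertex of A reaches g0 in one step, so b |-> b^-1 g0 covers A. *)
Lemma sum_reflect g0 : (forall g, g \in A -> (g0 * g^-1)%g \in F) ->
  \sum_(b <- F) f (b^-1 * g0)%g = \sum_(v <- A) f v.
Proof.
move=> AF; have -> : \sum_(b <- F) f (b^-1 * g0)%g =
    \sum_(u <- [fset (b^-1 * g0)%g | b in F]%fset) f u.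
  by rewrite big_imfset//= => u v _ _ /mulIg/invg_inj.
apply: sum_suppE => //; apply/fsubsetP => g gA; apply/imfsetP.
by exists (g0 * g^-1)%g; [exact: AF|rewrite invgM invgK mulgVK].
Qed.

Lemma avg_translate_le : (forall v, 0 <= f v) ->
  \sum_(z <- S) c * \sum_(b <- F) f (b^-1 * z)%g <= \sum_(v <- A) f v.
Proof.
move=> f0; rewrite -mulr_sumr exchange_big /= -[leRHS]mul1r -cF -mulrA.
rewrite ler_wpM2l// mulrC mulr_natr -iter_addr_0 -(count_predT F) -big_const_seq.
by apply: ler_sum => b _; exact: sum_translate_le.
Qed.

Lemma avg_translate : (thicken A `<=` S)%fset ->
  \sum_(z <- S) c * \sum_(b <- F) f (b^-1 * z)%g = \sum_(v <- A) f v.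
Proof.
move=> /fsubsetP AS; rewrite -mulr_sumr exchange_big /= -[RHS]mul1r -cF -mulrA.
congr (_ * _); rewrite mulrC mulr_natr -iter_addr_0 -(count_predT F).
rewrite -big_const_seq big_seq [RHS]big_seq; apply: eq_bigr => b bF.
by apply: sum_translate => g gA; apply: AS; exact: mem_thicken.
Qed.

End Sums.

Lemma sum_lazy_step s x :
  \sum_(z <- finsupp (lazy_step s x)) lazy_step s x z = \sum_(v <- finsupp x) x v.
Proof.
rewrite -(@sum_suppE _ _ _ (thicken (finsupp x)))//; first last.
- exact: finsupp_lazy_step.
- by move=> v; exact: fsfun_dflt.
under eq_bigr do rewrite lazy_stepE.
rewrite big_split/= -mulr_sumr -[X in _ + X]mulr_sumr.
rewrite (avg_translate (A := finsupp x) (f := x))//; last by move=> v; exact: fsfun_dflt.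
rewrite (@sum_suppE _ _ (finsupp x))//; first by rewrite -mulrDl subrK mul1r.
  by move=> v; exact: fsfun_dflt.
exact: sub_thicken.
Qed.

Section Distances.
Variables (x y : {fsfun G -> R with 0}) (A : {fset G}).
Hypotheses (xA : (finsupp x `<=` A)%fset) (yA : (finsupp y `<=` A)%fset).

Let S := thicken A.

Let off v : v \notin A -> x v = 0 /\ y v = 0.
Proof.
move=> vA; split; apply/fsfun_dflt/(contra _ vA).
  exact: (fsubsetP xA).
exact: (fsubsetP yA).
Qed.

Let dA v : v \notin A -> `|x v - y v| = 0.
Proof. by move=> /off[-> ->]; rewrite subrr normr0. Qed.

Let l1_S s : l1 (lazy_step s x) (lazy_step s y) =
  \sum_(z <- S) `|(1 - s) * (x z - y z) +
    s * (c * \sum_(b <- F) (x (b^-1 * z)%g - y (b^-1 * z)%g))|.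
Proof.
rewrite (@l1E _ _ _ _ S); first last.
- exact: fsubset_trans (finsupp_lazy_step _ _) (thickenS yA).
- exact: fsubset_trans (finsupp_lazy_step _ _) (thickenS xA).
apply: eq_bigr => z _; rewrite !lazy_stepE sumrB; congr `|_|.
by rewrite !mulrBr opprD addrACA.
Qed.

Lemma l1_lazy_step s : 0 <= s <= 1 -> l1 (lazy_step s x) (lazy_step s y) <= l1 x y.
Proof.
move=> /andP[s0 s1]; have s1' : 0 <= 1 - s by rewrite subr_ge0.
rewrite l1_S (l1E xA yA).
apply: (@le_trans _ _ (\sum_(z <- S) ((1 - s) * `|x z - y z| +
    s * (c * \sum_(b <- F) `|x (b^-1 * z)%g - y (b^-1 * z)%g|)))).
  apply: ler_sum => z _; apply: le_trans (ler_normD _ _) _.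
  rewrite !normrM (ger0_norm s0) (ger0_norm s1') (ger0_norm c_ge0).
  by rewrite lerD2l ler_wpM2l// ler_wpM2l//; exact: ler_norm_sum.
rewrite big_split/= -mulr_sumr -[X in _ + X]mulr_sumr.
rewrite (@sum_suppE _ _ A)//; last exact: sub_thicken.
rewrite (avg_translate (f := fun v => `|x v - y v|) dA)//.
by rewrite -mulrDl subrK mul1r.
Qed.

(** All the vertices of A give the same mass 1/|F| to g0, so the two laws agree
    at g0: what is lost there is the whole share l1 x y / |F| of the bound that
    the triangle inequality would give. *)
Lemma l1_lazy_step1 g0 :
    g0 \in A -> (forall g, g \in A -> (g0 * g^-1)%g \in F) ->
    \sum_(v <- finsupp x) x v = \sum_(v <- finsupp y) y v ->
  l1 (lazy_step 1 x) (lazy_step 1 y) <= (1 - #|` F|%:R^-1) * l1 x y.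
Proof.
move=> g0A AF xy; rewrite l1_S (l1E xA yA).
set D := \sum_(v <- A) _.
have D0 : \sum_(b <- F) (x (b^-1 * g0)%g - y (b^-1 * g0)%g) = 0.
  rewrite (@sum_reflect A (fun v => x v - y v))//; last first.
    by move=> v /off[-> ->]; rewrite subrr.
  by rewrite sumrB (@sum_suppE _ _ (finsupp x) A x)//
    ?(@sum_suppE _ _ (finsupp y) A y)// ?xy ?subrr// => v; exact: fsfun_dflt.
(* The term at z = g0 may be removed from the triangle inequality. *)
apply: (@le_trans _ _ (\sum_(z <- S) (c * (\sum_(b <- F)
    `|x (b^-1 * z)%g - y (b^-1 * z)%g|) - (if z == g0 then c * D else 0)))).
  apply: ler_sum => z _; rewrite subrr mul0r add0r mul1r normrM (ger0_norm c_ge0).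
  case: eqP => [->|_].
    rewrite D0 normr0 mulr0 subr_ge0 ler_wpM2l//.
    by rewrite (sum_reflect (f := fun v => `|x v - y v|) dA).
  by rewrite subr0 ler_wpM2l//; exact: ler_norm_sum.
rewrite sumrB (avg_translate (f := fun v => `|x v - y v|) dA)// -big_mkcond.
rewrite (fbig_pred1_inj _ _ (k := id))//; last exact: (fsubsetP (sub_thicken _)).
by rewrite mulrBl mul1r.
Qed.

Lemma l1_lazy_step_time s s' :
    (forall v, 0 <= x v) -> \sum_(v <- finsupp x) x v = 1 ->
  l1 (lazy_step s x) (lazy_step s' x) <= 2 * `|s - s'|.
Proof.
move=> x0 x1; rewrite (@l1E _ _ _ _ S); first last.
- exact: fsubset_trans (finsupp_lazy_step _ _) (thickenS xA).
- exact: fsubset_trans (finsupp_lazy_step _ _) (thickenS xA).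
have xoff v : v \notin A -> x v = 0 by move=> /off[].
have xA1 : \sum_(v <- A) x v = 1.
  by rewrite (@sum_suppE _ _ (finsupp x))// => v; exact: fsfun_dflt.
apply: (@le_trans _ _ (\sum_(z <- S) `|s - s'| *
    (x z + c * \sum_(b <- F) x (b^-1 * z)%g))).
  apply: ler_sum => z _; rewrite !lazy_stepE.
  set p := x z; set q := c * _.
  have p0 : 0 <= p by exact: x0.
  have q0 : 0 <= q by rewrite mulr_ge0// sumr_ge0.
  have -> : (1 - s) * p + s * q - ((1 - s') * p + s' * q) = (s - s') * (q - p) by lra.
  rewrite normrM ler_wpM2l// (le_trans (ler_normB _ _))//.
  by rewrite (ger0_norm p0) (ger0_norm q0) addrC.
rewrite -mulr_sumr big_split/= (avg_translate xoff)//.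
rewrite (@sum_suppE _ _ A)//; last exact: sub_thicken.
by rewrite xA1 mulrC.
Qed.

End Distances.
End LazyWalk.

(** * Maps that are Lipschitz on simplices *)

Section Lipschitz.
Variables (R : realType) (V W : choiceType).
Variables (K : simplicial_complex V) (L : simplicial_complex W).

(** The condition is only local, on pairs in a common simplex, because length
    metrics are controlled by the segments of broken lines; mapping such pairs to
    such pairs is what lets broken lines be transported. *)
Definition l1_lipschitz (c : R) (f : realization R K -> realization R L) : Prop :=
  forall x y, in_common_simplex x y ->
    in_common_simplex (f x) (f y) /\ l1 (f x) (f y) <= c * l1 x y.

Variables (D : nat) (c : R) (f : realization R K -> realization R L).
Hypotheses (dimK : forall A, K A -> (#|` A| <= D)%N) (c0 : 0 <= c).
Hypothesis fc : l1_lipschitz c f.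

(** The l1 and Euclidean lengths of a segment differ by a factor at most 2D, which
    is lost only once however small c is; iterating f therefore helps. *)
Lemma string_lipschitz x y l : string x y l ->
  exists2 l', string (f x) (f y) l' & l' <= c * (2 * D%:R) * l.
Proof.
elim=> [u|u v w m uv _ [m' vw mm']].
  by exists 0; [exact: string0|rewrite mulr0].
have [fuv luv] := fc uv.
exists (eucl (f u) (f v) + m'); first exact: string_cons vw.
rewrite mulrDr lerD// (le_trans (eucl_le_l1 _ _))// (le_trans luv)//.
rewrite -mulrA ler_wpM2l//; have [A [KA uA vA]] := uv.
apply: le_trans (l1_le_eucl uA vA) _.
by rewrite ler_wpM2r ?sqrtr_ge0// ler_wpM2l// ler_nat; exact: dimK.
Qed.

Lemma dist_lipschitz (lambda : R) x y :
  c * (2 * D%:R) <= lambda -> 0 < lambda ->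
  (dist (f x) (f y) <= lambda%:E * dist x y)%E.
Proof.
move=> clambda l0; rewrite -lee_pdivrMl//.
apply: le_ereal_inf_tmp => _ [l xyl <-].
have [l' fxy ll'] := string_lipschitz xyl.
rewrite lee_pdivrMl//; apply: (@le_trans _ _ l'%:E).
  by apply: ereal_inf_lbound; exists l'.
rewrite -EFinM lee_fin (le_trans ll')// ler_wpM2r//.
exact: string_ge0 xyl.
Qed.

End Lipschitz.

Lemma dist_ball_segment (R : realType) (V : choiceType)
    (K : simplicial_complex V) (x y : realization R K) (e : R) :
  in_common_simplex x y -> l1 x y < e -> dist_ball x e y.
Proof.
move=> xy le; apply/dist_ballP; exists (eucl x y + 0).
  exact: string_cons xy (string0 _).
by rewrite addr0 (le_lt_trans (eucl_le_l1 _ _)).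
Qed.

Section Continuity.
Variables (R : realType) (V W : choiceType).
Variables (K : simplicial_complex V) (L : simplicial_complex W).
Variables (D : nat) (c : R) (f : realization R K -> realization R L).
Hypotheses (dimK : forall A, K A -> (#|` A| <= D)%N) (c0 : 0 <= c).
Hypothesis fc : l1_lipschitz c f.

Lemma dist_ball_lipschitz x y (e : R) : 0 < e ->
  dist_ball x (e / (c * (2 * D%:R) + 1)) y -> dist_ball (f x) e (f y).
Proof.
move=> e0 /dist_ballP[l xyl le]; have l0 := string_ge0 xyl.
have [l' fxy ll'] := string_lipschitz dimK c0 fc xyl.
apply/dist_ballP; exists l' => //; apply: le_lt_trans ll' _.
set C := c * _ in le *; have C0 : 0 <= C by rewrite mulr_ge0// mulr_ge0.
move: le; rewrite ltr_pdivlMr ?ltr_wpDl//; nra.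
Qed.

Lemma lipschitz_continuous : continuous f.
Proof.
move=> x A /nbhs_ballP[e /= e0 eA]; apply/nbhs_ballP.
exists (e / (c * (2 * D%:R) + 1)).
  by rewrite /= divr_gt0// ltr_wpDl// mulr_ge0// mulr_ge0.
by move=> y xy; apply: eA; exact: dist_ball_lipschitz xy.
Qed.

End Continuity.

(** * The homotopy *)

Section Thickening.
Variables (R : realType) (G : groupType) (F : {fset G}) (K : simplicial_complex G).
Hypothesis F1 : 1%g \in F.

(** The simplices that carry the laws after one step from a point of K. *)
Definition thick_simplex (A : {fset G}) : Prop :=
  A != fset0 /\ exists B, K B /\ (A `<=` thicken F B)%fset.

Fact thick_simplex_neq0 A : thick_simplex A -> A != fset0.
Proof. by case. Qed.

Fact thick_simplex_face A B :
  thick_simplex B -> (A `<=` B)%fset -> A != fset0 -> thick_simplex A.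
Proof.
move=> [_ [C [KC BC]]] AB A0; split=> //.
by exists C; split=> //; exact: fsubset_trans BC.
Qed.

Definition thick_complex : simplicial_complex G :=
  SimplicialComplex thick_simplex_neq0 thick_simplex_face.

(** Clamping the time to [0, 1] makes the homotopy defined and continuous for all
    real times. *)
Definition clamp (s : R) : R := Num.min (Num.max 0 s) 1.

Lemma clamp_itv s : 0 <= clamp s <= 1.
Proof. by rewrite /clamp le_min le_max lexx ler01 ge_min lexx orbT. Qed.

Lemma clamp0 : clamp 0 = 0.
Proof. by rewrite /clamp maxxx min_l. Qed.

Lemma clamp1 : clamp 1 = 1.
Proof. by rewrite /clamp max_r// minxx. Qed.

Lemma clamp_lipschitz s s' : `|clamp s - clamp s'| <= `|s - s'|.
Proof.
have := ler_norm (s - s'); have := ler_norm (s' - s); rewrite distrC.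
rewrite ler_norml /clamp /Num.max /Num.min; move: `|_| => d ? ?.
case: (ltP 0 s) => ?; case: (ltP 0 s') => ?; apply/andP; split;
  do !case: ltP => ?; lra.
Qed.

Fact lazy_step_subproof s (x : realization R K) :
  `[< is_point thick_complex (lazy_step F (clamp s) x) >].
Proof.
have [Kx x0 x1] := realizationP x; apply/asboolP; split.
- split; last by exists (finsupp x); split=> //; exact: finsupp_lazy_step.
  apply/negP => /eqP st0; move: x1; rewrite -(sum_lazy_step F1 (clamp s)) st0.
  by rewrite big_seq_fset0 => /esym/eqP; rewrite oner_eq0.
- by move=> z; apply: (lazy_step_ge0 F1) => //; exact: clamp_itv.
- by rewrite sum_lazy_step.
Qed.

Definition real_step s (x : realization R K) : realization R thick_complex :=
  Point (lazy_step_subproof s x).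

Lemma real_step_common_simplex s s' (x y : realization R K) :
  in_common_simplex x y -> in_common_simplex (real_step s x) (real_step s' y).
Proof.
move=> [A [KA xA yA]]; exists (thicken F A); split.
- split; last by exists A.
  have /fset0Pn[g gA] := simplex_neq0 KA.
  by apply/fset0Pn; exists g; apply: (fsubsetP (sub_thicken F1 A)).
- exact: fsubset_trans (finsupp_lazy_step _ _ _) (thickenS _ xA).
- exact: fsubset_trans (finsupp_lazy_step _ _ _) (thickenS _ yA).
Qed.

End Thickening.

Section Spread.
Variables (R : realType) (G : groupType) (M : self_similar G) (K : ss_complex M).
Variables (F : {fset G}) (n : nat).
Hypothesis F1 : 1%g \in F.
Hypothesis KF : forall A g h, K A -> g \in A -> h \in A -> (g * h^-1)%g \in F.
Hypothesis long_section : forall v : n.-tuple (letter M),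
  simplicial (thick_complex F K) K (section v).

Local Notation S := (real_rset R K).

(** For a vertex g0 of A, the map g |-> g0 g^-1 embeds A into F. *)
Lemma card_simplex A : K A -> (#|` A| <= #|` F|)%N.
Proof.
move=> KA; have /fset0Pn[g0 g0A] := simplex_neq0 KA.
have <- : #|` [fset g0 * g^-1 | g in A]%fset|%g = #|` A|.
  by rewrite card_imfset// => g h /mulgI/invg_inj.
apply/fsubset_leq_card/fsubsetP => _ /imfsetP[g /= gA ->]; exact: KF KA _ _.
Qed.

Definition spread_word (s : R) (v : n.-tuple (letter M)) (x : realization R K) :
  realization R K := realize (long_section v) (real_step F1 s x).

Lemma spread_word_ract s v x g : spread_word s v (real_ract x g) =
  real_ract (spread_word s (word_act g v) x) (section v g).
Proof.
have step0 (y : realization R K) k : 0 <= lazy_step F (clamp s) y k.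
  by apply: (lazy_step_ge0 F1); [exact: clamp_itv|exact: weight_ge0].
apply: val_inj; rewrite /= lazy_step_push_mulr// !push_comp//.
by apply: eq_push => k _; rewrite /= sectionM.
Qed.

Lemma spread_word0 v x : spread_word 0 v x = Iword v x.
Proof. by apply: val_inj; rewrite /= clamp0 lazy_step0. Qed.

(** The homotopy x (x) v.h |-> I_v (lazy_step F s x).h; it does not depend on the
    representative by [spread_word_ract], see [spreadE]. *)
Definition spread (s : R) (t : tensor S (tpow M n)) : S :=
  ract (spread_word s (Defs.coord (repr t).2).1 (repr t).1 : S)
    (Defs.coord (repr t).2).2.

Lemma spreadE s (x : S) b :
  spread s (tens x b) = ract (spread_word s (Defs.coord b).1 x : S) (Defs.coord b).2.
Proof.
rewrite /spread; set t := tens _ _; have := tensE t; rewrite {1}/t.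
move: (repr t) => [y c] /= /tens_eqP[g [-> ->]].
rewrite -{3 4}(coordK c) lractA lact_word -ractM coordE.
by rewrite spread_word_ract real_ractM.
Qed.

Lemma spread0 t : spread 0 t = Imap t.
Proof.
rewrite (tensE t) spreadE; set b := (repr t).2.
by rewrite -[in RHS](coordK b) ImapE spread_word0.
Qed.

Lemma spread_equivariant s :
  equivariant (S := tensor_rset S (tpow M n)) (T := S) (spread s).
Proof.
move=> t h; rewrite (tensE t); move: (repr t) => [x b] /=.
by rewrite tensor_ractE !spreadE coord_ract ractM.
Qed.

Lemma spread_common_simplex s s' (x y : S) b : in_common_simplex x y ->
  in_common_simplex (spread s (tens x b)) (spread s' (tens y b)).
Proof.
move=> xy; rewrite !spreadE.
exact/realize_common_simplex/realize_common_simplex/real_step_common_simplex.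
Qed.

Lemma l1_spread s s' (x y : S) b :
  l1 (spread s (tens x b) : realization R K)
     (spread s' (tens y b) : realization R K) <=
  l1 (lazy_step F (clamp s) x) (lazy_step F (clamp s') y).
Proof.
by rewrite !spreadE; apply: le_trans (l1_push _ _ _) (l1_push _ _ _).
Qed.

Lemma spread_lipschitz s b : l1_lipschitz 1 (fun x : S => spread s (tens x b)).
Proof.
move=> x y xy; split; first exact: spread_common_simplex.
apply: le_trans (l1_spread _ _ _ _ _) _; rewrite mul1r; have [A [_ xA yA]] := xy.
exact: (l1_lazy_step F1 xA yA (clamp_itv s)).
Qed.

Lemma spread1_lipschitz b :
  l1_lipschitz (1 - #|` F|%:R^-1) (fun x : S => spread 1 (tens x b)).
Proof.
move=> x y xy; split; first exact: spread_common_simplex.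
apply: le_trans (l1_spread _ _ _ _ _) _; rewrite clamp1; have [A [KA xA yA]] := xy.
have /fset0Pn[g0 g0A] := simplex_neq0 KA.
apply: (l1_lazy_step1 F1 xA yA g0A) => [g gA|]; first exact: KF KA _ _.
by have [_ _ ->] := realizationP x; have [_ _ ->] := realizationP y.
Qed.

Lemma real_ract_lipschitz h :
  l1_lipschitz 1 (fun x : realization R K => real_ract x h).
Proof.
move=> x y xy; split; first exact: realize_common_simplex.
by rewrite mul1r; exact: l1_push.
Qed.

End Spread.

(** * Continuity and contraction *)

Section Quotient.
Variables (R : realType) (G : groupType) (M : self_similar G) (K : ss_complex M).
Variables (B : bimodule G).
Hypothesis ract_continuous :
  forall h, continuous (fun x : realization R K => real_ract x h).

(** The projection onto the tensor product is open, as the quotient map of a group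
    action by homeomorphisms: the saturation of V x {b}, for V open in Gamma, is a
    union of translates of it.  This gives joint continuity in the time and the point of the
    quotient, where the universal property of the quotient alone would not. *)
Lemma nbhs_tens (x : realization R K) (b : B) (U : set (realization R K)) :
  nbhs x U ->
  nbhs (tens (x : real_rset R K) b : tensor_space R K B)
    [set t | exists2 y, U y & t = tens (y : real_rset R K) b].
Proof.
rewrite [X in X _ -> _]nbhsE => -[Q [oQ Qx] QU]; rewrite nbhsE.
exists [set t | exists2 y, Q y & t = tens (y : real_rset R K) b]; last first.
  by move=> _ [y Qy ->]; exists y => //; exact: QU.
split; last by exists x.
rewrite /open /= /quotient_open openE => -[y c] /= [x' Qx' /tens_eqP[g [xE cE]]].
exists ((fun y' => real_ract y' g) @^-1` Q, [set c]); first split => /=.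
- by apply: ract_continuous; apply: open_nbhs_nbhs; split=> //; move: Qx'; rewrite xE.
- by [].
- move=> [y' c'] /= [Qy' ->]; exists (real_ract y' g) => //.
  by apply/tens_eqP; exists g.
Qed.
End Quotient.

Section SpreadContracting.
Variables (R : realType) (G : groupType) (M : self_similar G) (K : ss_complex M).
Variables (F : {fset G}) (n : nat).
Hypothesis F1 : 1%g \in F.
Hypothesis KF : forall A g h, K A -> g \in A -> h \in A -> (g * h^-1)%g \in F.
Hypothesis long_section : forall v : n.-tuple (letter M),
  simplicial (thick_complex F K) K (section v).

Local Notation S := (real_rset R K).
Local Notation spread := (@spread R G M K F n F1 long_section).

(** Moving the time moves the image along a segment of l1 length at most twice the
    change of time; moving the point at a fixed time is a Lipschitz map. *)
Lemma spread_continuous : continuous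
  (fun p : R * tensor_space R K (tpow M n) => spread p.1 p.2 : realization R K).
Proof.
have dimK := card_simplex KF.
move=> [s t]; have [x [b ->]] : exists (x : S) (b : tpow M n), t = tens x b.
  exists (repr (t : tensor S (tpow M n))).1, (repr (t : tensor S (tpow M n))).2.
  exact: (tensE (S := S)).
move=> A /nbhs_ballP[e /= e0 eA]; have e20 : 0 < e / 2 by rewrite divr_gt0.
set delta := e / 2 / (1 * (2 * (#|` F|)%:R) + 1).
have delta0 : 0 < delta by rewrite divr_gt0// mul1r ltr_wpDl// mulr_ge0.
exists (ball s (e / 4),
    [set t | exists2 y, dist_ball x delta y & t = tens (y : S) b]);
  first split => /=.
- by apply: nbhsx_ballx; rewrite divr_gt0.
- apply: nbhs_tens; last by apply/nbhs_ballP; exists delta.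
  move=> h; apply: (lipschitz_continuous dimK ler01).
  exact: real_ract_lipschitz.
move=> [s' _] /= [ss' [y xy ->]]; apply: eA.
have -> : e = e / 2 + e / 2 by lra.
apply: (@dist_ball_triangle _ _ _ _ (spread s' (tens x b))).
  apply: dist_ball_segment.
    apply: spread_common_simplex; exists (finsupp x).
    by have [] := realizationP x.
  apply: le_lt_trans (l1_spread _ _ _ _ _ _ _) _.
  have [_ x0 x1] := realizationP x.
  apply: le_lt_trans (l1_lazy_step_time F1 (fsubset_refl _) (fsubset_refl _)
    _ _ x0 x1) _.
  have := clamp_lipschitz s s'; move: ss'; rewrite /ball/=; lra.
exact: (dist_ball_lipschitz dimK ler01 (spread_lipschitz F1 long_section s' b)).
Qed.

Local Notation Psi :=
  (spread 1 : tensor_space R K (tpow M n) -> realization R K).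

Lemma iter_spread1_lipschitz (w : seq (tpow M n)) :
  l1_lipschitz ((1 - #|` F|%:R^-1) ^+ size w)
    (fun x => iter_tensor Psi x w).
Proof.
elim: w => [|b w IHw] x y xy /=; first by rewrite mul1r.
have [xy' l1xy] := spread1_lipschitz F1 KF long_section b xy.
have [xy'' l1xy'] := IHw _ _ xy'; split=> //.
apply: le_trans l1xy' _; rewrite exprSr -mulrA ler_wpM2l// exprn_ge0//.
by rewrite subr_ge0 invf_le1 ?ler1n ?ltr0n cardfs_gt0; apply/fset0Pn; exists 1%g.
Qed.

Lemma spread1_contracting : contracting_map Psi.
Proof.
split.
- move=> t A At.
  have [[P Q] /= [P1 Qt] PQ] := @spread_continuous (1, t) A At.
  apply: filterS Qt => t' Qt'; apply: (PQ (1, t')); split=> //=.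
  exact: nbhs_singleton P1.
- exact: spread_equivariant.
set q : R := 1 - #|` F|%:R^-1.
have F_gt0 : (0 < #|` F|)%N by rewrite cardfs_gt0; apply/fset0Pn; exists 1%g.
have q0 : 0 <= q by rewrite subr_ge0 invf_le1 ?ler1n ?ltr0n.
have q1 : `|q| < 1 by rewrite ger0_norm// gtrBl invr_gt0 ltr0n.
have C0 : 0 < 2 * #|` F|%:R :> R by rewrite mulr_gt0// ltr0n.
(* The power of q has to beat the comparison factor 2|F| of the two norms. *)
have [k k1 kq] : exists2 k, (1 <= k)%N & q ^+ k * (2 * #|` F|%:R) <= 2^-1.
  have /cvgrPdist_le/(_ (2^-1 / (2 * #|` F|%:R))) := cvg_expr q1.
  case=> [|k0 _ k0q]; first by rewrite divr_gt0.
  exists k0.+1 => //; have := k0q k0.+1 (leqnSn _).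
  by rewrite /= sub0r normrN ger0_norm ?exprn_ge0// ler_pdivlMr.
exists k, 2^-1; split=> //; first by apply/andP; split; lra.
move=> x y w; have := iter_spread1_lipschitz w; rewrite size_tuple => qw.
by apply: (dist_lipschitz (card_simplex KF) (exprn_ge0 k q0) qw x y kq).
Qed.

Lemma Imap_homotopic_spread1 :
  equivariantly_homotopic (@Imap G M R K n) Psi.
Proof.
exists (fun p => spread p.1 p.2); split=> //.
- exact/continuous_subspaceT/spread_continuous.
- by move=> s _; exact: spread_equivariant.
- by move=> t; exact: spread0.
Qed.

End SpreadContracting.

(** * Large levels of the tiling nerve *)

Section TilingNerve.
Variables (G : groupType) (M : self_similar G).
Hypothesis M_contracting : contracting_group M.

Lemma image_simplex_le m n (A : {fset G}) :
  (m <= n)%N -> image_simplex M n A -> image_simplex M m A.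
Proof.
move=> mn [v [h [B [KB ->]]]]; move: v; rewrite -(subnK mn) => v.
have [u [w ->]] := tuple_cat v.
exists w, h, (section u @` B)%fset; split; first exact: nucleus_complex_section.
rewrite (Defs.imfset_comp (fun g => section w g * h)%g (section u)).
by apply: eq_imfset_fun => g; rewrite (section_cat u w g).2.
Qed.

Lemma image_simplex_mulr n (A : {fset G}) h :
  image_simplex M n A -> image_simplex M n [fset (g * h)%g | g in A]%fset.
Proof.
move=> [v [k [B [KB ->]]]]; exists v, (k * h)%g, B; split=> //.
rewrite (Defs.imfset_comp (fun g => g * h)%g (fun g => section v g * k)%g).
by apply: eq_imfset_fun => g; rewrite mulgA.
Qed.

Lemma image_simplex_nucleus n (A : {fset G}) :
  image_simplex M n A -> nucleus_complex M A.
Proof.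
move=> [v [h [B [KB ->]]]].
rewrite -(Defs.imfset_comp (fun g => g * h)%g (section v)).
exact/nucleus_complex_ract/nucleus_complex_section.
Qed.

(** Up to translation a simplex is a subset of the nucleus, and each of these
    finitely many subsets that is not in Gamma leaves the images of the maps I^(n)
    at some finite level. *)
Lemma tiling_simplex_stable :
  exists n0, forall A, image_simplex M n0 A -> tiling_simplex M A.
Proof.
have [finN _] := nucleus_absorbing M_contracting.
have /choice[m mP] : forall B : {fset G}, exists m,
    image_simplex M m B -> tiling_simplex M B.
  move=> B; have [TB|/existsNP[m mB]] := pselect (tiling_simplex M B).
    by exists 0%N.
  by exists m.
pose P := fpowerset (fset_set (nucleus M)).
exists (\max_(B <- P) m B)%N => A An0.
have [A0 NA] := image_simplex_nucleus An0; have /fset0Pn[a aA] := A0.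
(* A translate of A that contains 1 is a subset of the nucleus. *)
pose B := [fset (g * a^-1)%g | g in A]%fset.
have AE : A = [fset (g * a)%g | g in B]%fset.
  rewrite (Defs.imfset_comp (fun g => g * a)%g (fun g => g * a^-1)%g).
  by rewrite -[LHS]imfset_id; apply: eq_imfset_fun => g; rewrite mulgVK.
have BP : B \in P.
  rewrite fpowersetE; apply/fsubsetP => _ /imfsetP[g /= gA ->].
  by rewrite in_fset_set// inE; exact: NA.
have TB : tiling_simplex M B.
  apply: mP; apply: image_simplex_le (image_simplex_mulr a^-1%g An0).
  exact: leq_bigmax_seq.
by move=> k; rewrite AE; exact: image_simplex_mulr.
Qed.

(** For a simplex B, the quotients of elements of F B are of the form b d c^-1
    with b, c in F and d in the nucleus: a finite set.  The first part of a long
    word brings all of them into the nucleus, and the rest of the word then lands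
    in the stable image Gamma. *)
Lemma long_section_thick (F : {fset G}) : exists n, (1 <= n)%N /\
  forall v : n.-tuple (letter M),
    simplicial (thick_complex F (tiling_nerve M)) (tiling_nerve M) (section v).
Proof.
have [finN absN] := nucleus_absorbing M_contracting.
have [n0 n0P] := tiling_simplex_stable.
have /choice[m mP] := absN.
pose E := [fset (p.1 * p.2 * q^-1)%g |
  p in (F `*` fset_set (nucleus M))%fset, q in F]%fset.
exists ((\max_(e <- E) m e).+1 + n0)%N; split=> // v.
have [u [w ->]] := tuple_cat v.
move=> A [A0 [B [TB AB]]]; apply: n0P.
exists w, 1%g, (section u @` A)%fset; split; last first.
  rewrite (Defs.imfset_comp (fun g => section w g * 1)%g (section u)).
  by apply: eq_imfset_fun => g; rewrite (section_cat u w g).2 mulg1.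
split; first exact: imfset_neq0.
move=> _ _ /imfsetP[g /= gA ->] /imfsetP[h /= hA ->]; rewrite sectionV.
apply: mP; apply/ltnW; rewrite ltnS; apply: leq_bigmax_seq => //.
have /imfset2P[b /= bF [x /= xB ->]] := fsubsetP AB _ gA.
have /imfset2P[c /= cF [y /= yB ->]] := fsubsetP AB _ hA.
have [_ NB] := image_simplex_nucleus (TB 0%N).
apply/imfset2P; exists (b, (x * y^-1)%g) => /=.
  by rewrite in_fsetM /= bF in_fset_set// inE; exact: NB.
by exists c => //; rewrite invgM !mulgA.
Qed.

End TilingNerve.

Theorem theorem6p6 (R : realType) (G : groupType) (M : self_similar G)
    (G_fg : finitely_generated G)
    (M_contracting : contracting_group M)
    (M_self_replicating : self_replicating M) :
  exists n : nat, (1 <= n)%N /\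
    exists Psi : tensor_space R (tiling_nerve M) (tpow M n) ->
                 realization R (tiling_nerve M),
      contracting_map Psi /\
      equivariantly_homotopic (@Imap G M R (tiling_nerve M) n) Psi.
Proof.
(* The nucleus is empty when there are no letters; otherwise it contains 1. *)
pose F := (1%g |` fset_set (nucleus M))%fset.
have F1 : 1%g \in F by exact: fset1U1.
have [finN _] := nucleus_absorbing M_contracting.
have KF A g h : tiling_nerve M A -> g \in A -> h \in A -> (g * h^-1)%g \in F.
  move=> TA gA hA; have [_ NA] := image_simplex_nucleus (TA 0%N).
  rewrite !inE in_fset_set// [X in _ || X]inE; apply/orP; right.
  by rewrite inE; exact: NA.
have [n [n1 long]] := long_section_thick M_contracting F.
exists n; split=> //; exists (spread F1 long 1); split.
  exact: spread1_contracting.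
exact: Imap_homotopic_spread1.
Qed.
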